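(* Let $\mathbb{F}$ be a field of characteristic different from $2$, let $n\ge2$ be an even integer and $m\ge1$ an integer. Let $\phi_{2n,2m+1}'\colon\mathbf{HSpin}_{2n}\times\mathbf{SO}_{2m+1}\hookrightarrow\mathbf{HSpin}_{2n(2m+1)}$ be the injection induced by the lifted Kronecker tensor product map. Then its Rost multipliers are described by $$(\phi_{2n,2m+1}')^\dagger(q_{\mathbf{HSpin}_{2n(2m+1)}})=(a\,q_{\mathbf{HSpin}_{2n}},\,b\,q_{\mathbf{SO}_{2m+1}}),\qquad (a,b)=\begin{cases}(2m+1,n)&\tfrac n2\equiv0\pmod4,\\(2m+1,2n)&\tfrac n2\equiv2\pmod4,\\(2m+1,4n)&\tfrac n2\equiv1,3\pmod4.\end{cases}$$
   Context: Groups (all split over $\mathbb{F}$). $\Omega_r$ is the $r\times r$ antidiagonal matrix of ones. $\mathbf{SO}_r=\{A: A\,\Omega_rA^T\Omega_r=I,\ \det A=1\}$; $\mathbf{Spin}_r\twoheadrightarrow\mathbf{SO}_r$ its spin double cover. For $N$ even, $\mathbf{HSpin}_{2N}=\mathbf{Spin}_{2N}/\{1,\xi_1\}$, $\xi_1=\prod_{k\text{ odd},\,k<N}h_{\alpha_k}(-1)$, where $\alpha_k=e_k-e_{k+1}$ and $h_\alpha(t)=\alpha^\vee(t)$ is the coroot cocharacter. Map. $\phi_{2n,2m+1}\colon\mathbf{Spin}_{2n}\times\mathbf{Spin}_{2m+1}\to\mathbf{Spin}_{2n(2m+1)}$ is the unique homomorphism whose composition with $\mathbf{Spin}_{2n(2m+1)}\twoheadrightarrow\mathbf{SO}_{2n(2m+1)}$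 is $\mathbf{Spin}_{2n}\times\mathbf{Spin}_{2m+1}\twoheadrightarrow\mathbf{SO}_{2n}\times\mathbf{SO}_{2m+1}\to\mathbf{SO}_{2n(2m+1)}$, the last map being the Kronecker product $(A,B)\mapsto A\otimes B$. For $n$ even, the composition of $\phi_{2n,2m+1}$ with $\mathbf{Spin}_{2n(2m+1)}\twoheadrightarrow\mathbf{HSpin}_{2n(2m+1)}$ factors through $\mathbf{HSpin}_{2n}\times\mathbf{SO}_{2m+1}$, giving the injection $\phi_{2n,2m+1}'$. Rost multipliers. For a split semisimple group $G$ with split maximal torus $T_G$, character lattice $T_G^*$ and Weyl group $W_G$, consider $S^2(T_G^* )^{W_G}$, the $W_G$-invariants of the second symmetric power; for simple $G$ it is infinite cyclic, generated by the normalized Killing form $q_G$, and for a product it contains the direct sum of the groups of the factors. A homomorphism $\varphi\colon G\to H$ (taking $T_G$ into $T_H$) induces $\varphi^*\colon T_H^*\to T_G^*$ and $\varphi^\dagger\colon S^2(T_H^* )^{W_H}\to S^2(T_G^* )^{W_G}$; writing the image of $q_H$ as an integral combination of the normalized Killing forms of the factors of $G$, the coefficients are the Rost multipliers. Here the tori come from the diagonal tori $\mathrm{diag}(s_1,\dots,s_r,(1),s_r^{-1},\dots,s_1^{-1})$ of $\mathbf{SO}_{2r}$ (or $\mathbf{SO}_{2r+1}$, with the middle entry 1), $e_i\mapsto s_i$, and all character lattices are viewed in $\bigoplus\mathbb{Q}e_i$. The normalized Killing forms are: $q_{\mathbf{SO}_{2r+1}}=\sum_{i=1}^re_i^2$;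 $q_{\mathbf{HSpin}_{4r}}=\lambda\sum_{i=1}^{2r}e_i^2$ with $\lambda=\tfrac12,1,2$ for $r\equiv0\pmod4$, $r\equiv2\pmod4$, $r$ odd respectively (for $r=1$, where the group is not simple, this formula is taken as the definition). *)

(* Defs.v *)
From mathcomp Require Export all_boot all_order all_algebra.
From mathcomp Require Export mxtens mpoly.

Set Implicit Arguments.
Unset Strict Implicit.
Unset Printing Implicit Defensive.

Import GRing.Theory.
Local Open Scope ring_scope.

(* Linear algebraic groups over a field F of characteristic different from 2
   are described in the classical language: a group is given by its points over
   an algebraically closed extension iota : F -> K, together with the F-algebra
   F[G] of those regular functions on it that are defined over F.  (All groups
   below are smooth.)  Homomorphisms and characters are F-morphisms. *)
Section AlgebraicGroups.
Variables (F : fieldType) (K : closedFieldType) (iota : {rmorphism F -> K}).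

(* The F-algebra of functions generated by a family of functions. *)
Inductive falg (T : Type) (gens : (T -> K) -> Prop) : (T -> K) -> Prop :=
  | falg_gen f : gens f -> falg gens f
  | falg_const c : falg gens (fun=> iota c)
  | falg_add f g : falg gens f -> falg gens g -> falg gens (fun x => f x + g x)
  | falg_mul f g : falg gens f -> falg gens g -> falg gens (fun x => f x * g x).

Record alggrp := AlgGrp {
  pt : Type;
  mem_grp : pt -> Prop;
  op : pt -> pt -> pt;
  reg : (pt -> K) -> Prop    (* only the restriction to mem_grp matters *)
}.

Definition generated (T : Type) (P : T -> Prop) (gens : (T -> K) -> Prop)
  (f : T -> K) : Prop :=
  exists2 g, falg gens g & forall x, P x -> f x = g x.

Definition is_hom (G H : alggrp) (f : pt G -> pt H) : Prop :=
  [/\ forall x, mem_grp x -> mem_grp (f x),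
      forall x y, mem_grp x -> mem_grp y -> f (op x y) = op (f x) (f y)
    & forall h, reg h -> reg (fun x => h (f x))].

Definition Gm : alggrp :=
  AlgGrp (fun x : K => x != 0) *%R
    (generated (fun x : K => x != 0)
       (fun f => f = id \/ f = (fun x : K => x^-1))).

(* A closed F-subgroup of GL_N, with F[GL_N] = F[x_ij, 1/det]. *)
Definition matgrp (N : nat) (P : 'M[K]_N -> Prop) : alggrp :=
  AlgGrp P (@mulmx K N N N)
    (generated P
       (fun f => (exists i j, f = fun A : 'M[K]_N => A i j)
                 \/ f = (fun A : 'M[K]_N => (\det A)^-1))).

Definition prodgrp (G H : alggrp) : alggrp :=
  let P := fun x : pt G * pt H => mem_grp x.1 /\ mem_grp x.2 in
  AlgGrp P (fun x y => (op x.1 y.1, op x.2 y.2))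
    (generated P
       (fun f => (exists2 g, reg g & f = fun x => g x.1)
                 \/ (exists2 h, reg h & f = fun x => h x.2))).

(* Regular functions on a closed subgroup are restrictions. *)
Definition subgrp (G : alggrp) (P : pt G -> Prop) : alggrp :=
  AlgGrp P (@op G)
    (fun f => exists2 g, reg g & forall x, P x -> f x = g x).

Definition Omega (r : nat) : 'M[K]_r :=
  \matrix_(i, j) (i == rev_ord j)%:R.

Definition SO (r : nat) : alggrp :=
  matgrp (fun A : 'M[K]_r =>
    A *m Omega r *m A^T *m Omega r = 1%:M /\ \det A = 1).

(* The Clifford algebra of the form v |-> v^T Omega v on K^r, in Chevalley's
   realization: it is the algebra of endomorphisms of the exterior algebra of
   K^r generated by the operators cliff v = (v wedge _) + (contraction by the
   linear form w |-> v^T Omega w), which satisfy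
   cliff v * cliff v = (v^T Omega v)%:M.
   The exterior algebra has the basis e_S, S a subset of 'I_r, where e_S is the
   wedge product of the e_i, i in S, taken in increasing order; endomorphisms
   are matrices acting on columns. *)
Definition extdim (r : nat) : nat := #|{set 'I_r}|.

Definition ext_sign (r : nat) (i : 'I_r) (S : {set 'I_r}) : K :=
  (-1) ^+ #|[set k in S | (k < i)%N]|.

Definition wedge (r : nat) (i : 'I_r) : 'M[K]_(extdim r) :=
  \matrix_(a, b)
    (let S : {set 'I_r} := enum_val b in
     if (i \notin S) && (enum_val a == i |: S) then ext_sign i S else 0).

Definition contract (r : nat) (i : 'I_r) : 'M[K]_(extdim r) :=
  \matrix_(a, b)
    (let S : {set 'I_r} := enum_val b in
     if (i \in S) && (enum_val a == S :\ i) then ext_sign i S else 0).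

Definition cliff_e (r : nat) (i : 'I_r) : 'M[K]_(extdim r) :=
  wedge i + contract (rev_ord i).

Definition cliff (r : nat) (v : 'cV[K]_r) : 'M[K]_(extdim r) :=
  \sum_i v i 0 *: cliff_e i.

Definition unit_vector (r : nat) (v : 'cV[K]_r) : bool :=
  v^T *m Omega r *m v == 1%:M.

(* The products of an even number of unit vectors of the Clifford algebra.
   Over the algebraically closed field K this is the whole spin group. *)
Definition Spin (r : nat) : alggrp :=
  matgrp (fun x : 'M[K]_(extdim r) =>
    exists s : seq 'cV[K]_r,
      [/\ ~~ odd (size s), all (@unit_vector r) s
        & x = \prod_(v <- s) cliff v]).

(* The double cover Spin_r ->> SO_r: x maps to the matrix A such that
   x e_j x^-1 = \sum_i A i j e_i in the Clifford algebra.  The coefficients are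
   read off by applying both sides to e_set0 = 1, since e_i applied to 1 is
   the basis vector indexed by [set i]. *)
Definition spin_cover (r : nat) (x : 'M[K]_(extdim r)) : 'M[K]_r :=
  \matrix_(i, j) (x *m cliff_e j *m invmx x) (enum_rank [set i])
                                             (enum_rank set0).

(* For i != j in the first half of 'I_r: the coroot cocharacter
   h_alpha : G_m -> Spin_r of the root alpha = e_i - e_j, that is, the lift of
   the cocharacter of SO_r with entries t, t^-1 at the places i, j (and t^-1, t
   at rev_ord i, rev_ord j).  Here e_i e_i' / 2 and e_i' e_i / 2, with
   i' = rev_ord i, are complementary idempotents.  When t = s^2, this is the
   product of s e_i e_i' / 2 + s^-1 e_i' e_i / 2, which acts on e_i by s^2, and
   of s^-1 e_j e_j' / 2 + s e_j' e_j / 2. *)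
Definition idem (r : nat) (i : 'I_r) : 'M[K]_(extdim r) :=
  2%:R^-1 *: (cliff_e i *m cliff_e (rev_ord i)).

Definition coroot (r : nat) (i j : 'I_r) (t : K) : 'M[K]_(extdim r) :=
  idem i *m idem j + idem (rev_ord i) *m idem (rev_ord j)
  + t *: (idem i *m idem (rev_ord j)) + t^-1 *: (idem (rev_ord i) *m idem j).

(* The product of h_{alpha_k}(-1), alpha_k = e_k - e_{k+1}, over the odd
   k < r/2, with k = i.+1 since ordinals start from 0. *)
Definition xi1 (r : nat) : 'M[K]_(extdim r) :=
  \prod_(i < r)
    \prod_(j < r | [&& ~~ odd i, j == i.+1 :> nat & (j < r./2)%N])
      coroot i j (-1).

(* HSpin_r, for r divisible by 4: cosets of {1, xi1} as sets of matrices, with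
   the product of sets; the regular functions are those whose pullback to Spin
   is regular. *)
Definition hspin_coset (r : nat) (x : 'M[K]_(extdim r)) :
  'M[K]_(extdim r) -> Prop := fun y => y = x \/ y = xi1 r *m x.

Definition HSpin (r : nat) : alggrp :=
  AlgGrp
    (fun X : 'M[K]_(extdim r) -> Prop =>
       exists2 x, @mem_grp (Spin r) x & X = hspin_coset x)
    (fun X Y z => exists x y, [/\ X x, Y y & z = x *m y])
    (fun f => @reg (Spin r) (fun x => f (hspin_coset x))).

(* A group with a split maximal torus, presented as the image of a torus
   [cov_mem] of a covering group under an isogeny [cov_map], together with the
   characters e_1, ..., e_rank of the cover that serve as coordinates. *)
Record torgrp := TorGrp {
  grp : alggrp;
  rank : nat;
  cov : Type;
  cov_mem : cov -> Prop;
  cov_map : cov -> pt grp;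
  cov_e : 'I_rank -> cov -> K
}.

Definition torus (G : torgrp) (t : pt (grp G)) : Prop :=
  exists2 s, @cov_mem G s & t = cov_map s.
Arguments torus : clear implicits.

(* The elements of T_G^*. *)
Definition character (G : torgrp) (chi : pt (grp G) -> K) : Prop :=
  @is_hom (subgrp (torus G)) Gm chi.

(* chi, viewed in the direct sum of the Q e_i, is \sum_i v_i e_i: for some
   d > 0 clearing the denominators of v, chi^d is \prod_i e_i^(d v_i). *)
Definition coords (G : torgrp) (chi : pt (grp G) -> K) (v : 'rV[rat]_(rank G))
  : Prop :=
  exists (d : nat) (z : 'I_(rank G) -> int),
    [/\ (0 < d)%N, forall i, d%:R * v 0 i = (z i)%:~R
      & forall s, @cov_mem G s ->
          chi (cov_map s) ^+ d = \prod_i @cov_e G i s ^ z i].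
Arguments coords : clear implicits.

(* L is (the row-vector matrix of the Q-linear extension of) phi^*. *)
Definition pullback (G H : torgrp) (phi : pt (grp G) -> pt (grp H))
  (L : 'M[rat]_(rank H, rank G)) : Prop :=
  forall chi v, character chi -> coords H chi v ->
    coords G (fun t => chi (phi t)) (v *m L).

(* The second symmetric power of the direct sum of the Q e_i is the space of
   quadratic forms in the variables e_i = 'X_i; it contains S^2 of the lattice
   T^* and its Weyl invariants, and phi^dagger is the restriction to these of
   the map induced by the Q-linear extension of phi^*.  [dagger phi q q'] says
   that phi maps T_G into T_H, that the Q-linear extension of phi^* exists and
   is uniquely determined, and that phi^dagger q = q'. *)
Definition dagger (G H : torgrp) (phi : pt (grp G) -> pt (grp H))
  (q : {mpoly rat[rank H]}) (q' : {mpoly rat[rank G]}) : Prop :=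
  (forall t, torus G t -> torus H (phi t)) /\
  exists L, unique (pullback phi) L /\
    q' = q \mPo [tuple \sum_j L i j *: 'X_j | i < rank H].

Lemma half_leq (r : nat) : (r./2 <= r)%N.
Proof. by rewrite -[X in (_ <= X)%N]odd_double_half -addnn addnA leq_addl. Qed.

Definition diag_e (r : nat) (i : 'I_r./2) (A : 'M[K]_r) : K :=
  A (widen_ord (half_leq r) i) (widen_ord (half_leq r) i).

(* A diagonal matrix in SO_r is diag(s_1, ..., (1), ..., s_1^-1), the middle
   entry being 1 by the determinant condition. *)
Definition torSO (r : nat) : torgrp :=
  TorGrp (grp := SO r)
    (fun A : 'M[K]_r => @mem_grp (SO r) A /\ is_diag_mx A) id (@diag_e r).

Definition torHSpin (r : nat) : torgrp :=
  TorGrp (grp := HSpin r)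
    (fun x => @mem_grp (Spin r) x /\ is_diag_mx (spin_cover x))
    (@hspin_coset r) (fun i x => diag_e i (spin_cover x)).

Definition torprod (G H : torgrp) : torgrp :=
  TorGrp (grp := prodgrp (grp G) (grp H)) (rank := (rank G + rank H)%N)
    (fun s : cov G * cov H => @cov_mem G s.1 /\ @cov_mem H s.2)
    (fun s => (cov_map s.1, cov_map s.2))
    (fun i s => match split i with
                | inl j => cov_e j s.1
                | inr k => cov_e k s.2
                end).

(* The canonical embeddings of S^2 of the factors in S^2 of the product. *)
Definition S2inl (k l : nat) (q : {mpoly rat[k]}) : {mpoly rat[k + l]} :=
  q \mPo [tuple 'X_(lshift l i) | i < k].
Definition S2inr (k l : nat) (q : {mpoly rat[l]}) : {mpoly rat[k + l]} :=
  q \mPo [tuple 'X_(rshift k i) | i < l].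

End AlgebraicGroups.

Arguments mem_grp {K} a _.
Arguments is_hom {K} G H f.
Arguments dagger {F K} iota G H phi q q'.

(* The normalized Killing forms, in the coordinates e_i; HSpin_r has r = 4k. *)
Definition q_SO (r : nat) : {mpoly rat[r./2]} := \sum_i 'X_i ^+ 2.

Definition hspin_lambda (r : nat) : rat :=
  let k := (r %/ 4)%N in
  if odd k then 2%:R else if (4 %| k)%N then 2%:R^-1 else 1.

Definition q_HSpin (r : nat) : {mpoly rat[r./2]} :=
  hspin_lambda r *: \sum_i 'X_i ^+ 2.

(* Main.v *)
(* For diagonal A and B, the entry of A (x) B at the place (i, j) is A_ii * B_jj, so the pullback of e_k is
   e_i + f_j, where f_j runs over d_1, .., d_m, 0, -d_m, .., -d_1 with d_1, .., d_m
   the coordinates of SO_2m+1.  As the f_j sum to 0 and their squares to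
   2 sum d_j^2, the sum of the e_k^2 is pulled back to
   (2m+1) sum e_i^2 + 2n sum d_j^2; the factor lambda is the
   same for HSpin_2n and HSpin_2n(2m+1), as n/2 and (n/2)(2m+1) are multiples of
   the same powers of 2.
   The group-theoretic input is that diagonal elements of SO lift to products of
   unit vectors of the Clifford algebra (needed to evaluate phi' on the torus),
   and that the functions e_k^2 are characters of the torus of HSpin, since xi1
   acts on vectors by -1; this determines the pullback uniquely. *)
From HB Require Import structures.
Require Import Defs.
From mathcomp Require Import all_boot all_order all_algebra.
From mathcomp Require Import mxtens mpoly ring zify.
From Stdlib Require Import FunctionalExtensionality ClassicalEpsilon.

Import GRing.Theory.
Local Open Scope ring_scope.

Set Implicit Arguments.
Unset Strict Implicit.
Unset Printing Implicit Defensive.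

(** * Clifford relations, and conjugation on the vectors of the Clifford algebra *)

Section Clifford.
Variable K : closedFieldType.
Implicit Types r : nat.

Lemma wedgeE r (i : 'I_r) a (S : {set 'I_r}) :
  wedge K i a (enum_rank S) =
  if i \notin S then ext_sign K i S * (a == enum_rank (i |: S))%:R else 0.
Proof.
rewrite mxE enum_rankK /=.
have ->: (enum_val a == i |: S) = (a == enum_rank (i |: S)).
  by rewrite -(inj_eq enum_rank_inj) enum_valK.
by case: (i \notin S); case: eqP; rewrite /= ?mulr1 ?mulr0.
Qed.

Lemma contractE r (i : 'I_r) a (S : {set 'I_r}) :
  contract K i a (enum_rank S) =
  if i \in S then ext_sign K i S * (a == enum_rank (S :\ i))%:R else 0.
Proof.
rewrite mxE enum_rankK /=.
have ->: (enum_val a == S :\ i) = (a == enum_rank (S :\ i)).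
  by rewrite -(inj_eq enum_rank_inj) enum_valK.
by case: (i \in S); case: eqP; rewrite /= ?mulr1 ?mulr0.
Qed.

Lemma mulmx_wedgeE r (M : 'M[K]_(extdim r)) (i : 'I_r) a (S : {set 'I_r}) :
  (M *m wedge K i) a (enum_rank S) =
  if i \notin S then ext_sign K i S * M a (enum_rank (i |: S)) else 0.
Proof.
rewrite mxE; under eq_bigr => c _ do rewrite wedgeE.
case: (i \notin S); last by rewrite big1 // => c _; rewrite mulr0.
rewrite (bigD1 (enum_rank (i |: S))) //= eqxx mulr1 mulrC big1 ?addr0 //.
by move=> c /negPf ->; rewrite !mulr0.
Qed.

Lemma mulmx_contractE r (M : 'M[K]_(extdim r)) (i : 'I_r) a (S : {set 'I_r}) :
  (M *m contract K i) a (enum_rank S) =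
  if i \in S then ext_sign K i S * M a (enum_rank (S :\ i)) else 0.
Proof.
rewrite mxE; under eq_bigr => c _ do rewrite contractE.
case: (i \in S); last by rewrite big1 // => c _; rewrite mulr0.
rewrite (bigD1 (enum_rank (S :\ i))) //= eqxx mulr1 mulrC big1 ?addr0 //.
by move=> c /negPf ->; rewrite !mulr0.
Qed.

Lemma ext_signU1 r (i j : 'I_r) (S : {set 'I_r}) : j \notin S ->
  ext_sign K i (j |: S) = (-1) ^+ (j < i)%N * ext_sign K i S.
Proof.
move=> jS; rewrite /ext_sign -exprD; congr (_ ^+ _).
case ji: (j < i)%N.
  have ->: [set k in j |: S | (k < i)%N] = j |: [set k in S | (k < i)%N].
    by apply/setP=> k; rewrite !inE; case: eqP => [->|] //=; rewrite ji.
  by rewrite cardsU1 inE (negPf jS).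
apply: eq_card => k; rewrite !inE; case: eqP => [->|] //=.
by rewrite ji andbF.
Qed.

Lemma ext_signD1 r (i j : 'I_r) (S : {set 'I_r}) : j \in S ->
  ext_sign K i (S :\ j) = (-1) ^+ (j < i)%N * ext_sign K i S.
Proof.
move=> jS; rewrite -{2}(setD1K jS) ext_signU1 ?inE ?eqxx //.
by rewrite mulrA -expr2 sqrr_sign mul1r.
Qed.

Lemma sign_ltn r (i j : 'I_r) : i != j ->
  (-1) ^+ (i < j)%N = - (-1) ^+ (j < i)%N :> K.
Proof.
by rewrite -val_eqE /=; case: ltngtP => //; rewrite ?expr0 ?expr1 ?opprK.
Qed.

Lemma sqr_ext_sign r (i : 'I_r) S : ext_sign K i S * ext_sign K i S = 1.
Proof. by rewrite -expr2 sqrr_sign. Qed.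

Lemma ext_mxP r (M N : 'M[K]_(extdim r)) :
  (forall a S, M a (enum_rank S) = N a (enum_rank S)) -> M = N.
Proof. by move=> MN; apply/matrixP=> a b; rewrite -[b]enum_valK. Qed.

(** Both composites insert [i] and [j]. In exactly one of the two orders the element inserted first
    lies below the second, which costs one extra sign. *)
Lemma wedge_anticomm r (i j : 'I_r) :
  wedge K i *m wedge K j + wedge K j *m wedge K i = 0.
Proof.
apply: ext_mxP => a S; rewrite mxE !mulmx_wedgeE !wedgeE mxE !inE.
have [->|ij] := eqVneq i j.
  by rewrite /= ?mulr0; case: ifP; rewrite addr0.
rewrite /=.
case jS: (j \in S); case iS: (i \in S); rewrite /= ?mulr0 ?addr0 //.
rewrite !ext_signU1 ?iS ?jS // (setUCA [set i]) (sign_ltn ij).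
by ring.
Qed.

Lemma contract_anticomm r (i j : 'I_r) :
  contract K i *m contract K j + contract K j *m contract K i = 0.
Proof.
apply: ext_mxP => a S; rewrite mxE !mulmx_contractE !contractE mxE !inE.
have [->|ij] := eqVneq i j.
  by rewrite /= ?mulr0; case: ifP; rewrite addr0.
rewrite /=.
case jS: (j \in S); case iS: (i \in S); rewrite /= ?mulr0 ?addr0 //.
rewrite !ext_signD1 ?iS ?jS // !setDDl (setUC [set i]) (sign_ltn ij).
by ring.
Qed.

(** For [i = j] exactly one composite is nonzero on each basis vector, and its two signs cancel. For
    [i != j] the composites are opposite, again because exactly one of [i < j] and [j < i] holds. *)
Lemma wedge_contract r (i j : 'I_r) :
  wedge K i *m contract K j + contract K j *m wedge K i = (i == j)%:R%:M.
Proof.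
apply: ext_mxP => a S; rewrite mxE mulmx_contractE mulmx_wedgeE.
rewrite wedgeE contractE !mxE !inE.
have [->|ij] := eqVneq i j; rewrite ?eqxx /=.
  case jS: (j \in S); rewrite /= ?mulr0 ?addr0 ?add0r mulrA.
    by rewrite ext_signD1 // ltnn mul1r sqr_ext_sign mul1r setD1K.
  rewrite ext_signU1 ?jS // ltnn mul1r sqr_ext_sign mul1r.
  by rewrite setU1K // jS.
rewrite /= mul0rn.
case jS: (j \in S); case iS: (i \in S); rewrite /= ?mulr0 ?addr0 //.
rewrite ext_signD1 // ext_signU1 ?iS //.
have ->: (i |: S) :\ j = i |: (S :\ j).
  by apply/setP=> k; rewrite !inE; case: (eqVneq k i) => // ->; rewrite ij.
rewrite (sign_ltn ij).
by ring.
Qed.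

Lemma cliff_e_anticomm r (i j : 'I_r) :
  cliff_e K i *m cliff_e K j + cliff_e K j *m cliff_e K i
  = ((i == rev_ord j)%:R *+ 2)%:M.
Proof.
rewrite /cliff_e !mulmxDl !mulmxDr.
(* Each of the products is paired with its reversal. Only the two mixed pairs of a wedge and a
   contraction survive; they contribute the same scalar, whence the factor 2. *)
rewrite [LHS](AC ((2*2)*(2*2)) ((1*5)*(2*7)*(6*3)*(4*8))) /=.
rewrite wedge_anticomm contract_anticomm !wedge_contract add0r addr0.
by rewrite (eq_sym j) (can2_eq (@rev_ordK r) (@rev_ordK r)) -raddfD -mulr2n.
Qed.

Lemma mul_cliffD r (u v : 'cV[K]_r) :
  cliff u *m cliff v + cliff v *m cliff u = ((u^T *m Omega K r *m v) 0 0 *+ 2)%:M.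
Proof.
have ->: (u^T *m Omega K r *m v) 0 0 = \sum_i \sum_j u i 0 * v j 0 * (i == rev_ord j)%:R.
  rewrite mxE exchange_big; apply: eq_bigr => j _ /=.
  rewrite mxE mulr_suml; apply: eq_bigr => i _.
  by rewrite !mxE mulrAC.
rewrite /cliff !mulmx_suml -sumrMnl raddf_sum /=.
under eq_bigr => i _ do rewrite mulmx_sumr.
under [X in _ + X]eq_bigr => i _ do rewrite mulmx_sumr.
rewrite [X in _ + X]exchange_big -big_split; apply: eq_bigr => i _ /=.
rewrite -sumrMnl raddf_sum -big_split; apply: eq_bigr => j _ /=.
rewrite -!scalemxAl -!scalemxAr !scalerA (mulrC (v j 0)) -scalerDr.
by rewrite cliff_e_anticomm scale_scalar_mx mulrnAr.
Qed.

Lemma cliff_eE r (i j : 'I_r) :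
  cliff_e K i (enum_rank [set j]) (enum_rank set0) = (j == i)%:R.
Proof.
rewrite mxE wedgeE contractE !inE /= addr0 setU0 (inj_eq enum_rank_inj).
rewrite (inj_eq set1_inj) /ext_sign.
rewrite (_ : [set k in _ | _] = set0) ?cards0 ?mul1r //.
by apply/setP=> k; rewrite !inE.
Qed.

Lemma cliff_is_linear r : linear (@cliff K r).
Proof.
move=> c u v; rewrite /cliff scaler_sumr -big_split; apply: eq_bigr => i _ /=.
by rewrite !mxE scalerDl scalerA.
Qed.
HB.instance Definition _ r :=
  GRing.isLinear.Build K 'cV[K]_r 'M[K]_(extdim r) _ (@cliff K r)
    (@cliff_is_linear r).

Lemma cliff_delta r (i : 'I_r) : cliff (delta_mx i 0) = cliff_e K i.
Proof.
rewrite /cliff (bigD1 i) //= mxE !eqxx scale1r big1 ?addr0 // => j /negPf ji.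
by rewrite mxE ji scale0r.
Qed.

Lemma cliffE r (v : 'cV[K]_r) i :
  cliff v (enum_rank [set i]) (enum_rank set0) = v i 0.
Proof.
rewrite /cliff summxE (bigD1 i) //= mxE cliff_eE eqxx mulr1 big1 ?addr0 //.
by move=> j ji; rewrite mxE cliff_eE eq_sym (negPf ji) mulr0.
Qed.

(** Conjugation by [x] acts on vectors as [A]. The equation is written without [invmx], so that
    products compose directly, and [x] may be any invertible matrix, such as a scalar multiple of a
    spin element. *)
Definition implements r (x : 'M[K]_(extdim r)) (A : 'M[K]_r) :=
  x \in unitmx /\ forall v, x *m cliff v = cliff (A *m v) *m x.

Lemma implements_spin_cover r (x : 'M[K]_(extdim r)) A :
  implements x A -> spin_cover x = A.
Proof.
move=> [ux xA]; apply/matrixP=> i j.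
by rewrite mxE -cliff_delta xA mulmxK // cliffE -colE mxE.
Qed.

Lemma implements1 r : implements (1%:M : 'M[K]_(extdim r)) 1%:M.
Proof. by split=> [|v]; rewrite ?unitmx1 // !mul1mx mulmx1. Qed.

Lemma implementsM r (x y : 'M[K]_(extdim r)) A B :
  implements x A -> implements y B -> implements (x *m y) (A *m B).
Proof.
move=> [ux xA] [uy yB]; split=> [|v]; first by rewrite unitmx_mul ux.
by rewrite -mulmxA yB mulmxA xA -!mulmxA.
Qed.

Lemma implementsZ r c (x : 'M[K]_(extdim r)) A :
  c != 0 -> implements x A -> implements (c *: x) A.
Proof.
move=> c0 [ux xA]; split=> [|v]; first by rewrite unitmxZ ?unitfE.
by rewrite -scalemxAl xA scalemxAr.
Qed.

Lemma cliff_sqr r (v : 'cV[K]_r) : 2%:R != 0 :> K ->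
  cliff v *m cliff v = ((v^T *m Omega K r *m v) 0 0)%:M.
Proof.
move=> two; have := mul_cliffD v v; rewrite -mulr2n raddfMn /= -!scaler_nat.
move=> /(congr1 (fun M => 2%:R^-1 *: M)).
by rewrite !scalerA mulVf // !scale1r.
Qed.

Lemma unit_vectorP r (v : 'cV[K]_r) :
  unit_vector v = ((v^T *m Omega K r *m v) 0 0 == 1).
Proof.
apply/eqP/eqP=> [->|v1]; first by rewrite mxE.
by apply/matrixP=> i j; rewrite !ord1 v1 mxE.
Qed.

(** For a unit vector [v] this is minus the reflection in the hyperplane orthogonal to [v]: it fixes
    [v] and negates the orthogonal complement. *)
Definition reflection r (v : 'cV[K]_r) : 'M[K]_r :=
  2%:R *: (v *m v^T *m Omega K r) - 1%:M.

(** As [cliff v] squares to 1, the relation v w = 2 B(v, w) - w v reads v w = (2 B(v, w) v - w) v,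
    where B is the bilinear form of [Omega]. *)
Lemma implements_reflection r (v : 'cV[K]_r) : 2%:R != 0 :> K ->
  unit_vector v -> implements (cliff v) (reflection v).
Proof.
move=> two; rewrite unit_vectorP => /eqP v1; have := cliff_sqr v two.
rewrite v1 => vv; split=> [|w]; first by case: (mulmx1_unit vv).
have := mul_cliffD v w; move/eqP; rewrite eq_sym -subr_eq => /eqP <-.
rewrite mulmxBl mul1mx raddfB /= -scalemxAl linearZ /=.
rewrite mulmxBl -scalemxAl; congr (_ - _).
rewrite -!mulmxA (mulmxA v^T) [v^T *m _ *m w]mx11_scalar mul_mx_scalar linearZ /=.
by rewrite -scalemxAl vv !scale_scalar_mx mulr1 mxE eqxx mulr_natl.
Qed.

Lemma scalar_mx_inj (n : nat) (i : 'I_n) : injective (@scalar_mx K n).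
Proof. by move=> a b /matrixP/(_ i i); rewrite !mxE eqxx. Qed.

(** The anticommutator of two vectors is twice their product under the form, and this scalar is
    unchanged by conjugation with [x]. *)
Lemma implements_orthogonal r (x : 'M[K]_(extdim r)) A (u v : 'cV[K]_r) :
    2%:R != 0 :> K -> implements x A ->
  ((A *m u)^T *m Omega K r *m (A *m v)) 0 0 = (u^T *m Omega K r *m v) 0 0.
Proof.
move=> two [ux xA].
have xAA (y z : 'cV[K]_r) : cliff (A *m y) *m cliff (A *m z) *m x = x *m (cliff y *m cliff z).
  by rewrite -mulmxA -xA mulmxA -xA -mulmxA.
have eqm : (((A *m u)^T *m Omega K r *m (A *m v)) 0 0 *+ 2)%:M *m x
         = x *m ((u^T *m Omega K r *m v) 0 0 *+ 2)%:M.
  by rewrite -!mul_cliffD mulmxDl mulmxDr !xAA.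
have := congr1 (mulmxr (invmx x)) eqm.
rewrite mul_mx_scalar -mul_scalar_mx /= !mulmxK //.
(* A scalar matrix determines its scalar only in nonzero size; the empty subset supplies an
   index. *)
pose o : 'I_(extdim r) := enum_rank (set0 : {set 'I_r}).
move/(scalar_mx_inj o); move/eqP.
by rewrite -subr_eq0 -mulrnBl -mulr_natl mulf_eq0 (negPf two) subr_eq0 => /eqP.
Qed.

Lemma implements_prod r (I : Type) (s : seq I) (P : pred I)
    (x : I -> 'M[K]_(extdim r)) (A : I -> 'M[K]_r) :
  (forall i, P i -> implements (x i) (A i)) ->
  implements (\prod_(i <- s | P i) x i) (\prod_(i <- s | P i) A i).
Proof.
move=> xA; apply: (big_rec2 (@implements r)); first exact: implements1.
by move=> i A' x' Pi; apply: implementsM; apply: xA.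
Qed.

(** A product of unit vectors implements the product of their [reflection] matrices. So
    [spin_cover], which reads off only some entries, does describe the conjugation on all
    vectors. *)
Lemma Spin_implements (F : fieldType) (iota : {rmorphism F -> K}) r x :
  2%:R != 0 :> K -> mem_grp (Spin iota r) x -> implements x (spin_cover x).
Proof.
move=> two [s [_ /allP s1 ->]].
suff xA: exists A, implements (\prod_(v <- s) cliff v) A.
  by case: xA => A xA; rewrite (implements_spin_cover xA).
exists (\prod_(v <- s) reflection v).
rewrite !big_seq; apply: implements_prod => v vs.
by apply: implements_reflection => //; apply: s1.
Qed.

End Clifford.

(** * Lifts of diagonal orthogonal matrices to the spin group, and the action of [xi1] *)

Section DiagonalLift.
Variables (F : fieldType) (K : closedFieldType) (iota : {rmorphism F -> K}).
Hypothesis two_neq0 : 2%:R != 0 :> K.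
Implicit Types r : nat.

Lemma cliff_e_sqr r (i : 'I_r) : i != rev_ord i -> cliff_e K i *m cliff_e K i = 0.
Proof.
move=> ii'; have := cliff_sqr (delta_mx i 0) two_neq0.
rewrite cliff_delta => ->; rewrite trmx_delta -rowE -colE !mxE (negPf ii').
by rewrite mulr0n raddf0.
Qed.

Lemma cliff_e_rev r (i : 'I_r) : i != rev_ord i ->
  cliff_e K i *m cliff_e K (rev_ord i) *m cliff_e K i = 2%:R *: cliff_e K i.
Proof.
move=> ii'; have := cliff_e_anticomm K i (rev_ord i).
rewrite rev_ordK eqxx => /(canRL (addrK _)) ->.
by rewrite mulmxBl -mulmxA cliff_e_sqr // mulmx0 subr0 mul_scalar_mx.
Qed.

Lemma cliff_eC r (i k : 'I_r) : k != rev_ord i ->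
  cliff_e K i *m cliff_e K k = - (cliff_e K k *m cliff_e K i).
Proof.
move=> ki; have := cliff_e_anticomm K i k.
rewrite eq_sym (can2_eq (@rev_ordK r) (@rev_ordK r)) (negPf ki).
by rewrite mulr0n mul0rn raddf0 => /eqP; rewrite addr_eq0 => /eqP.
Qed.

(** The vector e_k anticommutes with both factors of the idempotent, and the two signs cancel. *)
Lemma idemC r (i k : 'I_r) : k != i -> k != rev_ord i ->
  idem K i *m cliff_e K k = cliff_e K k *m idem K i.
Proof.
move=> ki ki'; rewrite -scalemxAl -scalemxAr; congr (_ *: _).
rewrite -mulmxA (@cliff_eC _ (rev_ord i) k) ?rev_ordK // mulmxN mulmxA (cliff_eC ki').
by rewrite mulNmx opprK mulmxA.
Qed.

Lemma idem_cliff_e r (i : 'I_r) : i != rev_ord i ->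
  idem K i *m cliff_e K i = cliff_e K i.
Proof.
move=> ii'; rewrite -scalemxAl cliff_e_rev // scalerA mulVf ?scale1r //.
Qed.

Lemma cliff_e_idem r (i : 'I_r) : i != rev_ord i ->
  cliff_e K i *m idem K i = 0.
Proof. by move=> ii'; rewrite -scalemxAr mulmxA cliff_e_sqr // mul0mx scaler0. Qed.

Lemma idem_rev_cliff_e r (i : 'I_r) : i != rev_ord i ->
  idem K (rev_ord i) *m cliff_e K i = 0.
Proof.
by move=> ii'; rewrite -scalemxAl rev_ordK -mulmxA cliff_e_sqr // mulmx0 scaler0.
Qed.

Lemma cliff_e_idem_rev r (i : 'I_r) : i != rev_ord i ->
  cliff_e K i *m idem K (rev_ord i) = cliff_e K i.
Proof.
move=> ii'; rewrite -scalemxAr rev_ordK mulmxA cliff_e_rev //.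
by rewrite scalerA mulVf ?scale1r.
Qed.

Lemma implements_diag r (x : 'M[K]_(extdim r)) (c : 'I_r -> K) :
  x \in unitmx -> (forall k, x *m cliff_e K k = c k *: (cliff_e K k *m x)) ->
  implements x (diag_mx (\row_k c k)).
Proof.
move=> ux xc; split=> // v; rewrite /cliff mulmx_sumr mulmx_suml.
apply: eq_bigr => k _; rewrite -scalemxAr xc scalerA -scalemxAl.
by rewrite mul_diag_mx !mxE mulrC.
Qed.

(** A lift of the diagonal matrix with entries [s ^+ 2] and [s ^- 2] at the places [i] and
    [rev_ord i]. The parameter gets squared, so lifting a given entry takes a square root. *)
Definition half_turn r (i : 'I_r) (s : K) : 'M[K]_(extdim r) :=
  s *: idem K i + s^-1 *: idem K (rev_ord i).

Definition turn_weight r (i : 'I_r) (t : K) (k : 'I_r) : K :=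
  if k == i then t else if k == rev_ord i then t^-1 else 1.

Lemma half_turn_Spin r (i : 'I_r) s : i != rev_ord i -> s != 0 ->
  mem_grp (Spin iota r) (half_turn i s).
Proof.
move=> ii' s0.
(* In the hyperbolic plane of e_i and e_i', with i' = [rev_ord i], the vector a e_i + b e_i' is a
   unit vector when ab = 1/2. Since e_i and e_i' square to 0, the product of [u] and [w] keeps only
   the terms in e_i e_i' and e_i' e_i. *)
pose u : 'cV[K]_r := 1 *: delta_mx i 0 + 2%:R^-1 *: delta_mx (rev_ord i) 0.
pose w : 'cV[K]_r := s^-1 *: delta_mx i 0 + (s / 2%:R) *: delta_mx (rev_ord i) 0.
have i'i : (rev_ord i == i) = false by rewrite eq_sym (negPf ii').
have Q a b : a * b = 2%:R^-1 -> @unit_vector K r (a *: delta_mx i 0 + b *: delta_mx (rev_ord i) 0).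
  move=> ab; rewrite unit_vectorP [(_ + _)^T]raddfD /= ![(_ *: _)^T]linearZ /= !trmx_delta.
  rewrite !mulmxDl !mulmxDr -!scalemxAl -!scalemxAr -!rowE -!colE.
  rewrite !mxE rev_ordK eqxx i'i (negPf ii') !mulr0 add0r addr0 !mulr1.
  by rewrite eqxx mulr1 (mulrC b) ab -mulr2n -(mulr_natr _^-1 2) mulVf.
exists [:: u; w]; split=> //=.
  by rewrite !Q ?mul1r // mulrA mulVf ?mul1r.
rewrite !big_cons big_nil mulr1 /u /w !linearD !linearZ /= !cliff_delta.
change (half_turn i s = (1 *: cliff_e K i + 2%:R^-1 *: cliff_e K (rev_ord i)) *m
  (s^-1 *: cliff_e K i + (s / 2%:R) *: cliff_e K (rev_ord i))).
rewrite scale1r mulmxDl !mulmxDr -!scalemxAl -!scalemxAr !cliff_e_sqr ?rev_ordK // 1?eq_sym //.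
rewrite !scaler0 add0r addr0 /half_turn /idem rev_ordK !scalerA.
by rewrite [s^-1 * _]mulrC.
Qed.

Lemma half_turn_implements r (i : 'I_r) s : i != rev_ord i -> s != 0 ->
  implements (half_turn i s) (diag_mx (\row_k turn_weight i (s ^+ 2) k)).
Proof.
move=> ii' s0; have i'i : rev_ord i != rev_ord (rev_ord i) by rewrite rev_ordK eq_sym.
apply: implements_diag => [|k].
  by case: (Spin_implements two_neq0 (half_turn_Spin ii' s0)).
rewrite /half_turn /turn_weight mulmxDl [cliff_e K k *m _]mulmxDr.
rewrite -!(scalemxAl _ (idem K _)) -!(scalemxAr _ _ (idem K _)).
have [->|ki] := eqVneq k i.
  rewrite idem_cliff_e // idem_rev_cliff_e // cliff_e_idem // cliff_e_idem_rev //.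
  by rewrite !scaler0 add0r addr0 scalerA expr2 mulfK.
have [->|ki'] := eqVneq k (rev_ord i).
  rewrite idem_cliff_e // cliff_e_idem // -[X in idem K X *m _]rev_ordK.
  rewrite -[X in _ *m idem K X]rev_ordK idem_rev_cliff_e // cliff_e_idem_rev //.
  by rewrite !scaler0 add0r addr0 scalerA expr2 invfM mulfVK.
by rewrite scale1r !idemC ?rev_ordK.
Qed.

Lemma closed_sqrt (a : K) : exists s, s ^+ 2 = a.
Proof.
have [s] := @solve_monicpoly K 2 (fun i => if i == 0%N then a else 0) isT.
by rewrite big_ord_recl big_ord1 /= expr0 mulr1 mul0r addr0; exists s.
Qed.

Lemma SpinM r x y : mem_grp (Spin iota r) x -> mem_grp (Spin iota r) y ->
  mem_grp (Spin iota r) (x *m y).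
Proof.
move=> [s [s_even s1 ->]] [t [t_even t1 ->]]; exists (s ++ t); split.
- by rewrite size_cat oddD (negPf s_even).
- by rewrite all_cat s1.
- by rewrite big_cat.
Qed.

Lemma prod_diag_mx r (I : Type) (s : seq I) (P : pred I) (c : I -> 'I_r -> K) :
  \prod_(i <- s | P i) diag_mx (\row_k c i k)
  = diag_mx (\row_k \prod_(i <- s | P i) c i k).
Proof.
elim: s => [|i s IHs].
  apply/matrixP=> a b; rewrite big_nil !mxE big_nil.
  by case: eqP.
rewrite big_cons; case Pi: (P i); last first.
  by rewrite IHs; congr diag_mx; apply/rowP=> k; rewrite !mxE big_cons Pi.
rewrite IHs [LHS]mulmx_diag; congr diag_mx; apply/rowP=> k.
by rewrite !mxE big_cons Pi.
Qed.

(** The matrix is a product of turns over the places [i < rev_ord i]. An entry in the first half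
    comes from its own turn, one in the second half from the turn at its mirror place, and a middle
    entry is 1. Each turn lifts to a [half_turn]. *)
Lemma diag_lift r (c : 'I_r -> K) :
  (forall k, c k * c (rev_ord k) = 1) -> (forall k, k = rev_ord k -> c k = 1) ->
  exists2 x, mem_grp (Spin iota r) x & implements x (diag_mx (\row_k c k)).
Proof.
move=> cV cmid.
have ->: diag_mx (\row_k c k)
    = \prod_(i < r | (i < rev_ord i)%N) diag_mx (\row_k turn_weight i (c i) k).
  rewrite prod_diag_mx; congr diag_mx; apply/rowP=> k; rewrite !mxE.
  have c0 j : c j != 0 by apply/eqP=> cj; move: (cV j); rewrite cj mul0r => /esym/eqP; rewrite oner_eq0.
  have [kk'|k'k|/val_inj kk'] := ltngtP (k : nat) (rev_ord k).
  - rewrite (bigD1 k) //= /turn_weight eqxx big1 ?mulr1 // => i /andP[ii' ik].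
    rewrite eq_sym (negPf ik); case: eqP => // ki'.
    by move: ii' kk'; rewrite ki' rev_ordK ltnNge => /negPf/[swap] /ltnW ->.
  - rewrite (bigD1 (rev_ord k)) ?rev_ordK //= /turn_weight rev_ordK eqxx big1 => [|i /andP[ii' ik]].
      have /negPf->: k != rev_ord k by rewrite -val_eqE /= gtn_eqF.
      by rewrite mulr1; apply: (mulfI (c0 (rev_ord k))); rewrite mulfV // mulrC cV.
    case: eqP => [ki|_]; first by move: ii' k'k; rewrite -ki ltnNge => /negPf/[swap] /ltnW ->.
    by case: eqP => // ki'; rewrite ki' rev_ordK eqxx in ik.
  - rewrite cmid // big1 // => i ii'; rewrite /turn_weight.
    case: eqP => [ki|_]; first by move: ii'; rewrite -ki -kk' ltnn.
    case: eqP => // ki'; move: ii' kk'; rewrite ki' rev_ordK => /[swap] ->.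
    by rewrite ltnn.
apply: (big_ind (fun A => exists2 x, mem_grp (Spin iota r) x & implements x A)).
- by exists 1%:M; [exists [::]; rewrite big_nil | exact: implements1].
- move=> A B [x xS xA] [y yS yB]; exists (x *m y); first exact: SpinM.
  exact: implementsM.
move=> i ii'; have [s sc] := closed_sqrt (c i).
have ni : i != rev_ord i by rewrite -val_eqE /= ltn_eqF.
have s0 : s != 0.
  apply: contra_eq_neq (cV i) => s0; rewrite -sc s0 expr0n mul0r eq_sym.
  exact: oner_neq0.
exists (half_turn i s); first exact: half_turn_Spin.
by rewrite -sc; apply: half_turn_implements.
Qed.

(** This is the [half_turn] with [s ^+ 2 = -1], divided by [s]; the scalar does not change the
    action. *)
Lemma grading_implements r (i : 'I_r) : i != rev_ord i ->
  implements (idem K i - idem K (rev_ord i))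
    (diag_mx (\row_k turn_weight i (-1) k)).
Proof.
move=> ii'; have [s s2] := closed_sqrt (-1).
have s0 : s != 0.
  by apply: contra_eq_neq s2 => ->; rewrite expr0n eq_sym oppr_eq0 oner_neq0.
have := implementsZ (invr_neq0 s0) (half_turn_implements ii' s0).
rewrite s2 /half_turn scalerDr !(scalerA _ _ (idem K _)) mulVf // scale1r -invfM -expr2 s2.
by rewrite invrN1 scaleN1r.
Qed.

(** Each coroot at -1 negates the places of one pair (i, i + 1), [i] even, together with their
    mirrors. As [r./2] is even, these pairs partition the first half, so every place is negated
    exactly once. *)
Lemma xi1_implements r : ~~ odd r -> ~~ odd r./2 -> implements (xi1 K r) (-1)%:M.
Proof.
move=> r_even h_even.
pose c (i j k : 'I_r) : K := turn_weight i (-1) k * turn_weight j (-1) k.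
have half_neq (i : 'I_r) : (i < r./2)%N -> i != rev_ord i.
  by move=> ih; rewrite -val_eqE /=; apply/eqP; lia.
have: implements (xi1 K r) (\prod_(i < r)
    \prod_(j < r | [&& ~~ odd i, j == i.+1 :> nat & (j < r./2)%N])
    diag_mx (\row_k c i j k)).
  apply: implements_prod => i _; apply: implements_prod => j /and3P[_ /eqP ji jh].
  have ih : (i < r./2)%N by rewrite -ji in jh *; lia.
  (* As -1 is its own inverse, the four terms of the coroot factor into one grading for [i] and one
     for [j]. *)
  have ->: coroot i j (-1) = (idem K i - idem K (rev_ord i)) *m
                             (idem K j - idem K (rev_ord j)).
    rewrite /coroot invrN1 !scaleN1r mulmxBl !mulmxBr opprB.
    by rewrite -!addrA; congr (_ + _); rewrite addrC addrAC addrA.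
  have ->: diag_mx (\row_k c i j k) = diag_mx (\row_k turn_weight i (-1) k)
     *m diag_mx (\row_k turn_weight j (-1) k).
    by rewrite mulmx_diag; congr diag_mx; apply/rowP=> k; rewrite !mxE.
  by apply: implementsM; apply: grading_implements; apply: half_neq.
suff ->: (\prod_(i < r) \prod_(j < r | [&& ~~ odd i, j == i.+1 :> nat & (j < r./2)%N])
    diag_mx (\row_k c i j k)) = (-1)%:M by [].
under eq_bigr => i _ do rewrite prod_diag_mx.
rewrite prod_diag_mx -diag_const_mx; congr diag_mx; apply/rowP=> k; rewrite !mxE.
(* The place of the first half whose turn acts on [k]. *)
pose l : 'I_r := if (k < r./2)%N then k else rev_ord k.
have lh : (l < r./2)%N.
  by rewrite /l; case: ifP => //= kh; have := ltn_ord k; lia.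
have wE (i : 'I_r) : (i < r./2)%N -> turn_weight i (-1) k = if i == l then -1 else 1.
  move=> ih; have ->: (i == l) = (k == i) || (k == rev_ord i).
    have := ltn_ord k; have := ltn_ord i.
    by rewrite /l; case: ifP => kh; rewrite -!val_eqE /=; lia.
  by rewrite /turn_weight invrN1; case: (k == i).
(* The only pair containing [l] starts at [l] rounded down to an even number; the evenness of [r./2]
   keeps its second member in the first half. *)
have i0r : (l./2.*2 < r)%N by have := ltn_ord l; lia.
have j0h : (l./2.*2.+1 < r./2)%N by lia.
have j0r : (l./2.*2.+1 < r)%N by lia.
rewrite (bigD1 (Ordinal i0r)) //= (bigD1 (Ordinal j0r)) /=; last first.
  by rewrite odd_double eqxx.
rewrite big1 => [|j /andP[/and3P[_ /eqP jE _] /negP[]]]; last by apply/eqP/val_inj.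
rewrite big1 => [|i i_neq].
  rewrite !mulr1 /c !wE //=; last by lia.
  rewrite -!val_eqE /=; case: eqP; case: eqP; rewrite ?mulr1 ?mul1r //; lia.
rewrite big1 // => j /and3P[i_even /eqP ji jh].
rewrite /c !wE //; last by lia.
rewrite -!val_eqE /= in i_neq *; case: eqP => il; first by lia.
by case: eqP => jl; [lia | rewrite mulr1].
Qed.

End DiagonalLift.

(** * Closure properties of algebras of functions defined over [F] *)

Section RegularFunctions.
Variables (F : fieldType) (K : closedFieldType) (iota : {rmorphism F -> K}).
Variables (T : Type) (gens : (T -> K) -> Prop).

Lemma falg_ext f g : f =1 g -> falg iota gens f -> falg iota gens g.
Proof. by move=> /functional_extensionality ->. Qed.

Lemma falg_sum (I : Type) (s : seq I) (P : pred I) (f : I -> T -> K) :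
  (forall i, falg iota gens (f i)) ->
  falg iota gens (fun x => \sum_(i <- s | P i) f i x).
Proof.
move=> fP; elim: s => [|i s IHs].
  by apply: (falg_ext _ (falg_const _ _ 0)) => x; rewrite big_nil rmorph0.
case Pi: (P i).
  by apply: (falg_ext _ (falg_add (fP i) IHs)) => x; rewrite big_cons Pi.
by apply: (falg_ext _ IHs) => x; rewrite big_cons Pi.
Qed.

Lemma falg_prod (I : Type) (s : seq I) (P : pred I) (f : I -> T -> K) :
  (forall i, falg iota gens (f i)) ->
  falg iota gens (fun x => \prod_(i <- s | P i) f i x).
Proof.
move=> fP; elim: s => [|i s IHs].
  by apply: (falg_ext _ (falg_const _ _ 1)) => x; rewrite big_nil rmorph1.
case Pi: (P i).
  by apply: (falg_ext _ (falg_mul (fP i) IHs)) => x; rewrite big_cons Pi.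
by apply: (falg_ext _ IHs) => x; rewrite big_cons Pi.
Qed.

Lemma falg_sign n : falg iota gens (fun=> (-1) ^+ n).
Proof. by apply: (falg_ext _ (falg_const _ _ ((-1) ^+ n))) => x; rewrite rmorph_sign. Qed.

Lemma falg_det n (f : T -> 'M[K]_n) :
  (forall i j, falg iota gens (fun x => f x i j)) ->
  falg iota gens (fun x => \det (f x)).
Proof.
move=> fP; apply: falg_sum => s; apply: falg_mul; first exact: falg_sign.
by apply: falg_prod => i; apply: fP.
Qed.

(** Cofactors are signed minors, hence polynomials in the entries. Together with 1/det they make the
    entries of an inverse matrix regular. *)
Lemma falg_adj n (f : T -> 'M[K]_n) i j :
  (forall i j, falg iota gens (fun x => f x i j)) ->
  falg iota gens (fun x => (\adj (f x)) i j).
Proof.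
move=> fP.
apply: (@falg_ext (fun x => (-1) ^+ (j + i)%N * \det (row' j (col' i (f x))))).
  by move=> x; rewrite mxE.
apply: falg_mul; first exact: falg_sign.
apply: falg_det => a b.
by apply: (falg_ext _ (fP (lift j a) (lift i b))) => x; rewrite !mxE.
Qed.

End RegularFunctions.

(** * Regularity of the double cover, and its diagonal values *)

Section SpinCover.
Variables (F : fieldType) (K : closedFieldType) (iota : {rmorphism F -> K}).
Hypothesis two_neq0 : 2%:R != 0 :> K.
Implicit Types r : nat.

(** The entries are sums of signs and zeros. This is what makes the entries of [spin_cover]
    functions over [F] and not merely over [K]. *)
Lemma cliff_e_const r (j : 'I_r) a b : exists c, cliff_e K j a b = iota c.
Proof.
rewrite mxE !mxE /=; set p := if _ then _ else _; set q := if _ then _ else _.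
suff [[c ->] [d ->]] : (exists c, p = iota c) /\ (exists d, q = iota d).
  by exists (c + d); rewrite rmorphD.
split; rewrite /p /q /ext_sign; case: ifP => _.
all: try by exists 0; rewrite rmorph0.
all: by eexists; rewrite -(rmorph_sign iota).
Qed.

Lemma spin_cover_regular r (i j : 'I_r) :
  @reg K (Spin iota r) (fun x => spin_cover x i j).
Proof.
pose R f := falg iota
  (fun f => (exists i j, f = fun A : 'M[K]_(extdim r) => A i j)
            \/ f = (fun A : 'M[K]_(extdim r) => (\det A)^-1)) f.
have entry a b : R (fun x => x a b) by apply: falg_gen; left; exists a, b.
(* Cramer's rule replaces [invmx x], with which it agrees because elements of [Spin] are
   invertible. *)
exists (fun x : 'M[K]_(extdim r) =>
  ((x *m cliff_e K j) *m ((\det x)^-1 *: \adj x)) (enum_rank [set i]) (enum_rank set0)).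
  apply: (@falg_ext _ _ _ _ _ (fun x : 'M[K]_(extdim r) =>
    \sum_c (\sum_b x (enum_rank [set i]) b * cliff_e K j b c)
      * ((\det x)^-1 * (\adj x) c (enum_rank set0)))).
    move=> x; rewrite mxE; apply: eq_bigr => c _.
    by rewrite [in RHS]mxE [in X in _ = _ * X]mxE.
  apply: falg_sum => c; apply: falg_mul.
    apply: falg_sum => b; apply: falg_mul; first exact: entry.
    by have [d ->] := cliff_e_const j b c; apply: falg_const.
  apply: falg_mul; first by apply: falg_gen; right.
  by apply: falg_adj => a b; apply: entry.
by move=> x xS; have [ux _] := Spin_implements (iota := iota) two_neq0 xS; rewrite mxE /invmx ux.
Qed.

(** Invariance of the form, applied to the dual pair of basis vectors at [i] and [rev_ord i]. *)
Lemma implements_diag_rev r (x : 'M[K]_(extdim r)) A i :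
  implements x A -> is_diag_mx A -> A i i * A (rev_ord i) (rev_ord i) = 1.
Proof.
move=> xA /diag_mxP[d Ad].
have := implements_orthogonal (delta_mx i 0) (delta_mx (rev_ord i) 0) two_neq0 xA.
have AE k : A *m delta_mx k 0 = A k k *: (delta_mx k 0 : 'cV[K]_r).
  apply/colP=> l; rewrite Ad mul_diag_mx !mxE !eqxx andbT mulr1n.
  by case: eqP => [->|]; rewrite ?mulr0.
rewrite !AE [(_ *: _)^T]linearZ /= -!scalemxAl -!scalemxAr !trmx_delta -!rowE -!colE.
by rewrite !mxE rev_ordK eqxx !mulr1.
Qed.

End SpinCover.

(** * The characters 2 e_i of the torus of the half-spin group *)

Section SquareCharacter.
Variables (F : fieldType) (K : closedFieldType) (iota : {rmorphism F -> K}).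
Hypothesis two_neq0 : 2%:R != 0 :> K.
Variable r : nat.
Hypotheses (r_even : ~~ odd r) (h_even : ~~ odd r./2).
Implicit Types (i : 'I_r) (X Y : 'M[K]_(extdim r) -> Prop).

Local Notation f i x := (spin_cover x i i ^+ 2).

(* The character 2 e_i: by [hspin_coset_implements], any choice of a
   representative gives the same value. *)
Definition square_char i X : K :=
  epsilon (inhabits 0) (fun c => exists2 x, X x & f i x = c).

Lemma square_charE i X c : (exists x, X x) -> (forall x, X x -> f i x = c) ->
  square_char i X = c.
Proof.
move=> [x0 Xx0] Xc; rewrite /square_char.
have [|x Xx <-] := epsilon_spec (inhabits 0) (fun c => exists2 x, X x & f i x = c).
  by exists (f i x0), x0.
exact: Xc.
Qed.

Lemma hspin_coset_implements (x y : 'M[K]_(extdim r)) :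
  mem_grp (Spin iota r) x -> hspin_coset x y ->
  implements y (spin_cover x) \/ implements y (- spin_cover x).
Proof.
move=> xS; have xA := Spin_implements (iota := iota) two_neq0 xS.
have xi := xi1_implements iota two_neq0 r_even h_even.
move=> [-> | ->]; first by left.
right; have ->: - spin_cover x = (-1)%:M *m spin_cover x by rewrite mul_scalar_mx scaleN1r.
exact: implementsM xi xA.
Qed.

Lemma square_char_coset i (x : 'M[K]_(extdim r)) :
  mem_grp (Spin iota r) x -> square_char i (hspin_coset x) = f i x.
Proof.
move=> xS; apply: square_charE; first by exists x; left.
move=> y /(hspin_coset_implements xS)[] /implements_spin_cover -> //.
by rewrite !mxE sqrrN.
Qed.

Lemma square_char_regular i : @reg K (HSpin iota r) (square_char i).
Proof.
have [g gR gE] := spin_cover_regular iota two_neq0 i i.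
exists (fun x => g x * g x); first exact: falg_mul.
by move=> x xS; rewrite square_char_coset // expr2 gE.
Qed.

(** Diagonal entries multiply on the torus, and squaring removes the sign ambiguity of the
    representatives. The inverse character is the one at [rev_ord i]. *)
Lemma square_char_character i : character iota (G := torHSpin iota r) (square_char i).
Proof.
have torE X : @torus K (torHSpin iota r) X -> exists2 x, X = hspin_coset x &
    mem_grp (Spin iota r) x /\ is_diag_mx (spin_cover x).
  by move=> [x xT ->]; exists x.
have inv X : @torus K (torHSpin iota r) X ->
    square_char i X * square_char (rev_ord i) X = 1.
  move=> /torE[x -> [xS xD]]; rewrite !square_char_coset // -exprMn.
  rewrite (implements_diag_rev two_neq0 i (Spin_implements two_neq0 xS) xD).
  by rewrite expr1n.
split=> /=.
- move=> X /inv; apply: contra_eq_neq => ->; rewrite mul0r eq_sym; exact: oner_neq0.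
- move=> X Y /torE[x -> [xS xD]] /torE[y -> [yS yD]].
  rewrite !square_char_coset //; apply: square_charE.
    by exists (x *m y), x, y; split=> //; left.
  move=> z [x' [y' [xx' yy' ->]]].
  have [d Ad] := diag_mxP _ xD; have [e Be] := diag_mxP _ yD.
  have AB : (spin_cover x *m spin_cover y) i i = spin_cover x i i * spin_cover y i i.
    by rewrite Ad Be mulmx_diag !mxE eqxx !mulr1n.
  have ABN : (- (spin_cover x *m spin_cover y)) i i = - (spin_cover x i i * spin_cover y i i).
    by rewrite mxE AB.
  have [xA|xA] := hspin_coset_implements xS xx';
  have [yB|yB] := hspin_coset_implements yS yy';
  rewrite (implements_spin_cover (implementsM xA yB)) ?mulNmx ?mulmxN ?opprK
    ?ABN ?AB ?sqrrN exprMn //.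
move=> h [g gR gE].
(* The induction over functions of t and 1/t produces functions regular on all of [HSpin], compared
   with the pullback only on the torus: there 1/t becomes the [square_char] at [rev_ord i]. *)
suff [g' g'R g'E] : exists2 g', @reg K (HSpin iota r) g' &
    forall X, @torus K (torHSpin iota r) X -> g (square_char i X) = g' X.
  exists g' => // X XT; rewrite -g'E // gE //.
  by apply: contra_eq_neq (inv X XT) => ->; rewrite mul0r eq_sym; exact: oner_neq0.
elim: gR => {h g gE} [g|c|g h _ [g' [g1 g1R g1E] g'E] _ [h' [h1 h1R h1E] h'E]
                     |g h _ [g' [g1 g1R g1E] g'E] _ [h' [h1 h1R h1E] h'E]].
- case=> ->; first by exists (square_char i) => //; apply: square_char_regular.
  exists (square_char (rev_ord i)); first exact: square_char_regular.
  move=> X XT; have e := inv X XT.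
  have s0 : square_char i X != 0.
    by apply: contra_eq_neq e => ->; rewrite mul0r eq_sym; exact: oner_neq0.
  by apply: (mulfI s0); rewrite e mulfV.
- by exists (fun=> iota c) => //; exists (fun=> iota c) => //; apply: falg_const.
- exists (fun X => g' X + h' X) => [|X XT]; last by rewrite g'E ?h'E.
  by exists (fun x => g1 x + h1 x) => [|x xS]; [apply: falg_add | rewrite g1E ?h1E].
- exists (fun X => g' X * h' X) => [|X XT]; last by rewrite g'E ?h'E.
  by exists (fun x => g1 x * h1 x) => [|x xS]; [apply: falg_mul | rewrite g1E ?h1E].
Qed.

Lemma square_char_coords (k : 'I_r./2) :
  @coords K (torHSpin iota r) (square_char (widen_ord (Defs.half_leq r) k))
    (2%:R *: delta_mx 0 k).
Proof.
exists 1%N, (fun i : 'I_r./2 => (2 * (i == k))%N%:Z); split=> // [i|s [sS _]].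
  by rewrite !mxE eqxx /= mul1r -natrM.
rewrite square_char_coset // expr1 (bigD1 k) //= eqxx muln1 big1 ?mulr1 //.
by move=> i /negPf ->; rewrite muln0.
Qed.

End SquareCharacter.

(** * Diagonal entries of a torus element as monomials in the coordinates *)

Section Weights.

Definition fst_half r (l : 'I_r./2) : 'I_r := widen_ord (Defs.half_leq r) l.

Lemma fst_half_lt_rev r (l : 'I_r./2) : (fst_half l < rev_ord (fst_half l))%N.
Proof. by have := ltn_ord l; rewrite /=; lia. Qed.

Lemma fst_half_inj r : injective (@fst_half r).
Proof. by move=> a b /(congr1 val)/= /val_inj. Qed.

Lemma fst_half_neq_rev r (a b : 'I_r./2) :
  (fst_half a == rev_ord (fst_half b)) = false.
Proof.
apply/negP=> /eqP ab; have := fst_half_lt_rev a; have := fst_half_lt_rev b.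
by rewrite ab rev_ordK -ab => ? ?; lia.
Qed.

(** Reversal fixes the middle index [m] and matches the remaining indices of the first half with
    those of the second. *)
Lemma big_rev_odd (R : Type) (idx : R) (op : Monoid.com_law idx) (m : nat)
    (g : 'I_(2 * m).+1 -> R) :
  \big[op/idx]_j g j = op (g (inord m))
    (\big[op/idx]_(l < (2 * m).+1./2)
       op (g (fst_half l)) (g (rev_ord (fst_half l)))).
Proof.
rewrite (bigD1 (inord m)) //=; congr (op _ _).
rewrite (bigID (fun j : 'I__ => (j < (2 * m).+1./2)%N)) big_split /=.
have mE : nat_of_ord (inord m : 'I_(2 * m).+1) = m by rewrite inordK //; lia.
congr (op _ _).
  rewrite -(big_ord_narrow (F := g) (Defs.half_leq _)); apply: eq_bigl => j.
  by rewrite -val_eqE /= mE; lia.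
rewrite (reindex_inj rev_ord_inj) /=.
rewrite -(big_ord_narrow (F := (fun j => g (rev_ord j))) (Defs.half_leq _)).
by apply: eq_bigl => j; rewrite -val_eqE /= mE; have := ltn_ord j; lia.
Qed.

(* The coordinates, in the basis of the e_l, of the j-th diagonal entry of
   diag(s_1, ..., (1), ..., s_1^-1). *)
Definition weight r (j : 'I_r) (l : 'I_r./2) : int :=
  (j == fst_half l)%:Z - (j == rev_ord (fst_half l))%:Z.

Lemma weight_fst r (a l : 'I_r./2) : weight (fst_half a) l = (a == l)%:Z.
Proof. by rewrite /weight fst_half_neq_rev subr0 (inj_eq (@fst_half_inj r)). Qed.

Lemma weight_rev r (j : 'I_r) l : weight (rev_ord j) l = - weight j l.
Proof.
rewrite /weight opprB (inj_eq rev_ord_inj); congr (_ - _%:Z).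
by rewrite (can2_eq (@rev_ordK r) (@rev_ordK r)).
Qed.

Lemma weight_mid r (j : 'I_r) l : j = rev_ord j -> weight j l = 0.
Proof. by move=> jj; have := weight_rev j l; rewrite -jj; lia. Qed.

Lemma ord_halfP r (j : 'I_r) :
  [\/ exists l, j = fst_half l, exists l, j = rev_ord (fst_half l)
    | j = rev_ord j].
Proof.
have jr := ltn_ord j.
have [jj|jj|/val_inj jj] := ltngtP (j : nat) (rev_ord j); last by apply: Or33.
  have jh : (j < r./2)%N by move: jj => /=; lia.
  by apply: Or31; exists (Ordinal jh); apply: val_inj.
have jh : (rev_ord j < r./2)%N by move: jj => /=; lia.
by apply: Or32; exists (Ordinal jh); apply: (can_inj (@rev_ordK r)); rewrite rev_ordK; apply: val_inj.
Qed.

(** The conditions on the diagonal of a torus element: mirror entries are inverse, and a middle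
    entry, which exists only for odd [r], is 1. *)
Definition torus_entries (K : fieldType) r (c : 'I_r -> K) :=
  (forall k, c k * c (rev_ord k) = 1) /\ (forall k, k = rev_ord k -> c k = 1).

Lemma torus_entries_neq0 (K : fieldType) r (c : 'I_r -> K) k :
  torus_entries c -> c k != 0.
Proof.
move=> [cV _]; apply: contra_eq_neq (cV k) => ->.
by rewrite mul0r eq_sym oner_neq0.
Qed.

Lemma torus_entriesE (K : fieldType) r (c : 'I_r -> K) : torus_entries c ->
  forall j, c j = \prod_l c (fst_half l) ^ weight j l.
Proof.
move=> cT; have [cV cmid] := cT.
have fstE a : c (fst_half a) = \prod_l c (fst_half l) ^ weight (fst_half a) l.
  rewrite (bigD1 a) //= weight_fst eqxx big1 ?mulr1 // => l la.
  by rewrite weight_fst eq_sym (negPf la).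
move=> j; have [[l ->]|[l ->]|jj] := ord_halfP j; first exact: fstE.
  apply: (mulfI (torus_entries_neq0 (fst_half l) cT)); rewrite cV.
  rewrite {1}fstE -big_split /= big1 // => a _.
  by rewrite weight_rev -expfzDr ?subrr // torus_entries_neq0.
by rewrite cmid // big1 // => l _; rewrite weight_mid.
Qed.

(** These one-parameter families move a single coordinate and serve to prove that the coordinates
    are independent. *)
Lemma torus_entries_turn (K : closedFieldType) r (a : 'I_r./2) (t : K) : t != 0 ->
  torus_entries (turn_weight (fst_half a) t).
Proof.
move=> t0; have aa := fst_half_neq_rev a a; split=> k; rewrite /turn_weight.
  rewrite (inj_eq rev_ord_inj) (can2_eq (@rev_ordK r) (@rev_ordK r)).
  case: (eqVneq k (fst_half a)) => [->|_]; first by rewrite aa mulfV.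
  by case: eqP => _; rewrite ?mulVf ?mulr1.
move=> kk; case: eqP => [ka|_]; first by move: aa; rewrite -ka -kk eqxx.
by case: eqP => // ka; move: aa; rewrite -[fst_half a]rev_ordK -ka -!kk eqxx.
Qed.

End Weights.

(** * The sum of squares under the Kronecker substitution *)

Section QuadraticForm.
Variables (R : comNzRingType) (n m : nat).
Local Notation p := (2 * n)%N.
Local Notation q := (2 * m).+1.
Variables (X : 'I_p./2 -> R) (Z : 'I_q./2 -> R).

(** The matrix of the map taking e_k to e_i + f_j, where (i, j) is the pair encoded by the place
    [fst_half k]. *)
Definition kron_weight r s (k : 'I_(r * s)./2) (l : 'I_(r./2 + s./2)) : int :=
  let ij := mxtens_unindex (fst_half k) in
  match split l with inl a => weight ij.1 a | inr b => weight ij.2 b end.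

Lemma kron_weight_l r s (k : 'I_(r * s)./2) a :
  kron_weight k (lshift _ a) = weight (mxtens_unindex (fst_half k)).1 a.
Proof. by rewrite /kron_weight (unsplitK (inl _ a)). Qed.

Lemma kron_weight_r r s (k : 'I_(r * s)./2) b :
  kron_weight k (rshift _ b) = weight (mxtens_unindex (fst_half k)).2 b.
Proof. by rewrite /kron_weight (unsplitK (inr _ b)). Qed.

(** Pairs are ordered lexicographically and [p] is even, so the first half of the [p * q] places
    consists of the pairs with [i] in the first half and [j] arbitrary. *)
Lemma sum_fst_half_kron (g : 'I_p -> 'I_q -> R) :
  \sum_k g (mxtens_unindex (@fst_half (p * q) k)).1 (mxtens_unindex (fst_half k)).2
  = \sum_a \sum_j g (fst_half a) j.
Proof.
pose G k := g (@mxtens_unindex p q k).1 (mxtens_unindex k).2.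
rewrite -(big_ord_narrow (F := G) (Defs.half_leq _)).
rewrite -(big_ord_narrow (F := (fun i => \sum_j g i j)) (Defs.half_leq _)).
rewrite pair_big_dep (reindex (@mxtens_index p q)) /=; last first.
  by exists (@mxtens_unindex p q) => i _; rewrite (mxtens_indexK, mxtens_unindexK).
apply: eq_big => [[i j]|[i j] _] /=; last by rewrite /G mxtens_indexK.
have := ltn_ord j; rewrite andbT; nia.
Qed.

Lemma sum_sqr_kron :
  \sum_(k < (p * q)./2)
     ((\sum_a X a *~ kron_weight k (lshift _ a))
      + (\sum_b Z b *~ kron_weight k (rshift _ b))) ^+ 2
  = (\sum_a X a ^+ 2) *+ q + (\sum_b Z b ^+ 2) *+ p.
Proof.
pose u i := \sum_a X a *~ weight (i : 'I_p) a.
pose f j := \sum_b Z b *~ weight (j : 'I_q) b.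
transitivity (\sum_k (u (mxtens_unindex (@fst_half (p * q) k)).1
                      + f (mxtens_unindex (fst_half k)).2) ^+ 2).
  apply: eq_bigr => k _; congr ((_ + _) ^+ 2); apply: eq_bigr => l _.
    by rewrite kron_weight_l.
  by rewrite kron_weight_r.
rewrite (sum_fst_half_kron (fun i j => (u i + f j) ^+ 2)).
have uE a : u (fst_half a) = X a.
  rewrite /u (bigD1 a) //= weight_fst eqxx big1 ?addr0 // => b ba.
  by rewrite weight_fst eq_sym (negPf ba).
have fE b : f (fst_half b) = Z b.
  rewrite /f (bigD1 b) //= weight_fst eqxx big1 ?addr0 // => a ab.
  by rewrite weight_fst eq_sym (negPf ab).
have frev j : f (rev_ord j) = - f j.
  by rewrite /f -sumrN; apply: eq_bigr => b _; rewrite weight_rev mulrNz.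
have fmid : f (inord m) = 0.
  rewrite /f big1 // => b _; rewrite weight_mid //.
  by apply: val_inj; rewrite /= !inordK; lia.
have sum_f : \sum_j f j = 0.
  by rewrite big_rev_odd /= fmid add0r big1 // => l _; rewrite frev subrr.
have sum_f2 : \sum_j f j ^+ 2 = (\sum_b Z b ^+ 2) *+ 2.
  rewrite big_rev_odd /= fmid expr0n add0r -sumrMnl; apply: eq_bigr => l _.
  by rewrite frev sqrrN fE mulr2n.
transitivity (\sum_(a < p./2) (X a ^+ 2 *+ q + (\sum_b Z b ^+ 2) *+ 2)).
  apply: eq_bigr => a _; rewrite uE.
  under eq_bigr => j _ do rewrite sqrrD.
  rewrite !big_split /= sum_f2 sumr_const card_ord.
  by rewrite -mulr_sumr sum_f mulr0 !addr0.
(* Each of the [n] values of [a] contributes twice the second sum of squares, which gives [p]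
   copies. *)
rewrite big_split /= sumrMnl sumr_const card_ord -mulrnA; congr (_ + _ *+ _).
by lia.
Qed.

End QuadraticForm.

(** * Uniqueness of coordinates, and diagonal elements of the groups *)

Section Tori.
Variables (F : fieldType) (K : closedFieldType) (iota : {rmorphism F -> K}).
Implicit Types r : nat.

(** Raising both expressions of [chi] to the common power [d1 * d2] gives a multiplicative relation
    between the coordinates, which independence makes trivial. *)
Lemma coords_unique (G : torgrp K) chi v1 v2 :
  (forall s i, @cov_mem K G s -> cov_e i s != 0) ->
  (forall z : 'I_(rank G) -> int,
     (forall s, @cov_mem K G s -> \prod_i cov_e i s ^ z i = 1) -> z =1 (fun=> 0)) ->
  @coords K G chi v1 -> @coords K G chi v2 -> v1 = v2.
Proof.
move=> e0 indep [d1 [z1 [d1_gt0 zE1 chiE1]]] [d2 [z2 [d2_gt0 zE2 chiE2]]].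
have zE : (fun i => z1 i * d2%:Z - z2 i * d1%:Z) =1 (fun=> 0).
  apply: indep => s sG.
  have e : (\prod_i cov_e i s ^ z1 i) ^+ d2 = (\prod_i cov_e i s ^ z2 i) ^+ d1.
    by rewrite -chiE1 // -chiE2 // -!exprM mulnC.
  transitivity ((\prod_i cov_e i s ^ z1 i) ^+ d2 / (\prod_i cov_e i s ^ z2 i) ^+ d1).
    rewrite -!prodrXl -prodfV -big_split /=; apply: eq_bigr => i _.
    by rewrite expfzDr ?e0 // -invr_expz -!exprz_exp.
  by rewrite e mulfV // expf_neq0 //; apply/prodf_neq0 => i _; rewrite expfz_neq0 ?e0.
have d0 d : (0 < d)%N -> d%:R != 0 :> rat by rewrite Num.Theory.pnatr_eq0 lt0n.
apply/rowP=> i; apply: (mulfI (d0 _ d1_gt0)); apply: (mulfI (d0 _ d2_gt0)).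
rewrite zE1 [in RHS]mulrCA zE2 !pmulrn -!intrM; congr _%:~R.
by have /eqP := zE i; rewrite subr_eq0 => /eqP; rewrite mulrC => ->; rewrite mulrC.
Qed.

Lemma Spin_torus_entries r (x : 'M[K]_(extdim r)) : 2%:R != 0 :> K -> ~~ odd r ->
  mem_grp (Spin iota r) x -> is_diag_mx (spin_cover x) ->
  torus_entries (fun k => spin_cover x k k).
Proof.
move=> two_neq0 r_even xS xD; split=> k.
  have xA := Spin_implements (iota := iota) two_neq0 xS.
  by have := implements_diag_rev two_neq0 k xA xD.
move=> kk; have := ltn_ord k.
by move: (congr1 val kk) => /=; lia.
Qed.

Lemma diag_mulOmega r (A : 'M[K]_r) : is_diag_mx A ->
  A *m Omega K r *m A^T *m Omega K r
  = diag_mx (\row_k (A k k * A (rev_ord k) (rev_ord k))).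
Proof.
move=> /diag_mxP[d Ad].
have AE k : A k k = d 0 k by rewrite Ad mxE eqxx mulr1n.
apply/matrixP=> i j; rewrite mxE [in RHS]mxE mxE !AE {AE}.
rewrite (bigD1 (rev_ord j)) //= big1 => [|k kj].
  rewrite Ad tr_diag_mx mul_mx_diag mul_diag_mx !mxE eqxx addr0 mulr1.
  rewrite rev_ordK; case: eqP => [->|]; last by rewrite mulr0 mul0r.
  by rewrite mulr1.
by rewrite [X in _ * X]mxE (negPf kj) mulr0.
Qed.

(** Once mirror entries are inverse, they cancel in the determinant and leave the middle entry. *)
Lemma diag_SOP m (A : 'M[K]_((2 * m).+1)) : is_diag_mx A ->
  mem_grp (SO iota (2 * m).+1) A <-> torus_entries (fun k => A k k).
Proof.
move=> AD; have [d Ad] := diag_mxP _ AD.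
have AE k : A k k = d 0 k by rewrite Ad mxE eqxx mulr1n.
have midE (k : 'I_(2 * m).+1) : k = rev_ord k -> k = inord m.
  by move=> /(congr1 val) /= kk; apply: val_inj; rewrite /= inordK; have := ltn_ord k; lia.
have detE : (forall k, A k k * A (rev_ord k) (rev_ord k) = 1) ->
    \det A = A (inord m) (inord m).
  move=> AV; rewrite [in LHS]Ad det_diag big_rev_odd /= AE big1 ?mulr1 // => l _.
  by rewrite -!AE AV.
rewrite /= diag_mulOmega //; split=> [[AO A1]|[AV Amid]].
  have AV k : A k k * A (rev_ord k) (rev_ord k) = 1.
    by move/matrixP/(_ k k): AO; rewrite !mxE eqxx !mulr1n.
  by split=> // k /midE ->; rewrite -detE.
split; last by rewrite detE // Amid //; apply: val_inj; rewrite /= !inordK; lia.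
rewrite -diag_const_mx; congr diag_mx; apply/rowP=> k.
by rewrite !mxE AV.
Qed.

End Tori.

Lemma diag_mx_entries (R : nzRingType) r (A : 'M[R]_r) :
  is_diag_mx A -> A = diag_mx (\row_k A k k).
Proof.
move=> /diag_mxP[d ->]; congr diag_mx; apply/rowP=> k.
by rewrite !mxE eqxx mulr1n.
Qed.

Lemma is_diag_tensmx (R : comNzRingType) r s (A : 'M[R]_r) (B : 'M[R]_s) :
  is_diag_mx A -> is_diag_mx B -> is_diag_mx (tensmx A B).
Proof.
move=> /is_diag_mxP AD /is_diag_mxP BD; apply/is_diag_mxP => k l.
case: (mxtens_indexP k) => i j; case: (mxtens_indexP l) => i' j'.
rewrite tensmxE; have [<-|ii'] := eqVneq i i'; last by rewrite AD ?mul0r.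
have [<-|jj'] := eqVneq j j'; last by rewrite [B _ _]BD ?mulr0.
by rewrite eqxx.
Qed.

(** * The Kronecker homomorphism on tori, its pullback and its multipliers *)

Section Kronecker.
Variables (F : fieldType) (K : closedFieldType) (iota : {rmorphism F -> K}).
Hypothesis two_neq0 : 2%:R != 0 :> K.
Variables n m : nat.
Hypothesis n_even : ~~ odd n.
Local Notation p := (2 * n)%N.
Local Notation q := (2 * m).+1.
Local Notation source := (torprod iota (torHSpin iota p) (torSO iota q)).
Local Notation target := (torHSpin iota (p * q)).

Lemma source_cov_e_l (s : cov source) (a : 'I_p./2) :
  @cov_e K source (lshift _ a) s = spin_cover s.1 (fst_half a) (fst_half a).
Proof. by rewrite /= (unsplitK (inl _ a)). Qed.

Lemma source_cov_e_r (s : cov source) (b : 'I_q./2) :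
  @cov_e K source (rshift _ b) s = s.2 (fst_half b) (fst_half b).
Proof. by rewrite /= (unsplitK (inr _ b)). Qed.

Lemma source_entries (s : cov source) : cov_mem s ->
  torus_entries (fun k => spin_cover s.1 k k) /\ torus_entries (fun k => s.2 k k).
Proof.
move=> [[xS xD] [AS AD]]; split.
  by apply: (Spin_torus_entries (iota := iota)) => //; rewrite ?mul2n ?odd_double.
by have [H _] := diag_SOP iota AD; apply: H.
Qed.

Lemma source_cov_e_neq0 (s : cov source) i : cov_mem s -> @cov_e K source i s != 0.
Proof.
move=> /source_entries[s1 s2]; case: (split_ordP i) => j ->.
  by rewrite source_cov_e_l (torus_entries_neq0 _ s1).
by rewrite source_cov_e_r (torus_entries_neq0 _ s2).
Qed.

Lemma source_lift (c1 : 'I_p -> K) (c2 : 'I_q -> K) :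
  torus_entries c1 -> torus_entries c2 ->
  exists s : cov source, [/\ cov_mem s,
    forall a, @cov_e K source (lshift _ a) s = c1 (fst_half a)
    & forall b, @cov_e K source (rshift _ b) s = c2 (fst_half b)].
Proof.
move=> c1T c2T; have [c1V c1mid] := c1T.
have [x xS xA] := diag_lift iota two_neq0 c1V c1mid.
exists (x, diag_mx (\row_k c2 k)); split.
- split; first by split=> //; rewrite (implements_spin_cover xA) diag_mx_is_diag.
  split; last exact: diag_mx_is_diag.
  apply/(diag_SOP iota (diag_mx_is_diag _)).
  have [c2V c2mid] := c2T.
  by split=> k *; rewrite !mxE !eqxx !mulr1n ?c2V ?c2mid.
- by move=> a; rewrite source_cov_e_l (implements_spin_cover xA) !mxE eqxx mulr1n.
- by move=> b; rewrite source_cov_e_r !mxE eqxx mulr1n.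
Qed.

(** A root of -1 of order |z| works, since -1 differs from 1 in characteristic other than 2. *)
Lemma closed_exprz_neq1 (z : int) : z != 0 -> exists2 t : K, t != 0 & t ^ z != 1.
Proof.
have N1 : -1 != 1 :> K by rewrite eq_sym -subr_eq0 opprK.
have root k : exists2 t : K, t != 0 & t ^+ k.+1 = -1.
  have [t] := @solve_monicpoly K k.+1 (fun i => if i == 0%N then -1 else 0) isT.
  rewrite big_ord_recl /= expr0 mulr1 big1 ?addr0 => [tk|i _]; last by rewrite mul0r.
  exists t => //; apply: contra_eq_neq tk => ->.
  by rewrite expr0n /= eq_sym oppr_eq0 oner_neq0.
case: z => [[//|k]|k] _; have [t t0 tk] := root k; exists t => //.
  by rewrite -exprnP tk.
by rewrite NegzE -invr_expz -exprnP tk invrN1.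
Qed.

Lemma source_prod (f : 'I_(rank source) -> K) : \prod_i f i
  = (\prod_(a < p./2) f (lshift _ a)) * (\prod_(b < q./2) f (rshift _ b)).
Proof. exact: big_split_ord. Qed.

Lemma source_independent (z : 'I_(rank source) -> int) :
  (forall s, cov_mem s -> \prod_i @cov_e K source i s ^ z i = 1) -> z =1 (fun=> 0).
Proof.
move=> z1 i; apply/eqP/negP=> /negP /closed_exprz_neq1[t t0 /eqP[]].
have one_entries r : @torus_entries K r (fun=> 1) by split=> // k; rewrite mulr1.
case: (split_ordP i) => j ->.
  have [s [sG s1 s2]] := source_lift (torus_entries_turn j t0) (one_entries _).
  rewrite -[RHS](z1 s sG) source_prod [X in _ * X]big1 => [|b _].
    rewrite (bigD1 j) // big1 => [|a /andP[_ aj]]; rewrite s1 /turn_weight.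
      by rewrite eqxx /= !mulr1.
    by rewrite (inj_eq (@fst_half_inj _)) (negPf aj) fst_half_neq_rev exp1rz.
  by rewrite s2 exp1rz.
have [s [sG s1 s2]] := source_lift (one_entries _) (torus_entries_turn j t0).
rewrite -[RHS](z1 s sG) source_prod big1 => [|a _].
  rewrite (bigD1 j) // big1 => [|b /andP[_ bj]]; rewrite s2 /turn_weight.
    by rewrite eqxx /= mulr1 mul1r.
  by rewrite (inj_eq (@fst_half_inj _)) (negPf bj) fst_half_neq_rev exp1rz.
by rewrite s1 exp1rz.
Qed.

Variable phi : pt (prodgrp iota (Spin iota p) (Spin iota q)) -> pt (Spin iota (p * q)).
Hypothesis phi_hom : is_hom _ _ phi.
Hypothesis phi_lift : forall x y,
  mem_grp (Spin iota p) x -> mem_grp (Spin iota q) y ->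
  spin_cover (phi (x, y)) = tensmx (spin_cover x) (spin_cover y).
Variable phi' : pt (prodgrp iota (HSpin iota p) (SO iota q)) -> pt (HSpin iota (p * q)).
Hypothesis phi'_factor : forall x y,
  mem_grp (Spin iota p) x -> mem_grp (Spin iota q) y ->
  phi' (hspin_coset x, spin_cover y) = hspin_coset (phi (x, y)).

(** The map [phi'] is given only on cosets paired with images of spin elements, so the diagonal
    component in [SO] is first lifted by [diag_lift]. *)
Lemma kron_lift (s : cov source) : cov_mem s ->
  exists2 u : cov target, cov_mem u &
    phi' (cov_map s) = cov_map u /\ spin_cover u = tensmx (spin_cover s.1) s.2.
Proof.
move=> sG; have [_ [AV Amid]] := source_entries sG.
have [y yS yA] := diag_lift iota two_neq0 AV Amid.
case: s sG {AV Amid} yA => x A [/= [xS xD] [AS AD]].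
rewrite -(diag_mx_entries AD) => yA.
have phiE := phi_lift xS yS; rewrite (implements_spin_cover yA) in phiE.
exists (phi (x, y)).
  split; first by case: phi_hom => phi_mem _ _; apply: phi_mem.
  by rewrite phiE is_diag_tensmx.
split; last exact: phiE.
by rewrite /= -phi'_factor // (implements_spin_cover yA).
Qed.

Definition kron_pullback : 'M[rat]_(rank target, rank source) :=
  \matrix_(k, l) (kron_weight k l)%:~R.

Lemma kron_cov_e (s : cov source) (u : cov target) k : cov_mem s ->
  spin_cover u = tensmx (spin_cover s.1) s.2 ->
  @cov_e K target k u = \prod_l @cov_e K source l s ^ kron_weight k l.
Proof.
move=> /source_entries[/torus_entriesE s1 /torus_entriesE s2] uE.
rewrite source_prod [LHS]/= /diag_e uE mxE.
rewrite (s1 (mxtens_unindex (fst_half k)).1) (s2 (mxtens_unindex (fst_half k)).2).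
congr (_ * _); apply: eq_bigr => l _.
  by rewrite kron_weight_l -source_cov_e_l.
by rewrite kron_weight_r -source_cov_e_r.
Qed.

Lemma kron_pullbackP : pullback iota (G := source) (H := target) phi' kron_pullback.
Proof.
move=> chi v _ [d [z [d_gt0 zE chiE]]].
(* The weights are integral, so the denominator [d] of [v] still clears [v *m kron_pullback]. *)
exists d, (fun l => \sum_k z k * kron_weight k l); split=> // [l|s sG].
  rewrite mxE mulr_sumr rmorph_sum /=; apply: eq_bigr => k _.
  by rewrite mxE mulrA zE intrM.
have [u uG [-> uE]] := kron_lift sG; rewrite chiE //.
transitivity (\prod_k \prod_l (@cov_e K source l s ^ kron_weight k l) ^ z k).
  apply: eq_bigr => k _; rewrite (kron_cov_e k sG uE).
  exact: (big_morph (fun x : K => x ^ z k) (fun x y => expfzMl x y _) (exp1rz _ _)).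
rewrite exchange_big; apply: eq_bigr => l _ /=.
rewrite (big_morph (fun w => @cov_e K source l s ^ w) (id1 := 1) (op1 := *%R)) //.
  by apply: eq_bigr => k _; rewrite exprz_exp mulrC.
by move=> w w'; rewrite expfzDr // source_cov_e_neq0.
Qed.

(** The characters 2 e_k span the rational character space of the target; the image of each one
    fixes twice a row of the matrix. *)
Lemma kron_pullback_unique : unique (pullback iota (G := source) (H := target) phi') kron_pullback.
Proof.
split=> [|L LP]; first exact: kron_pullbackP.
have r_even : ~~ odd (p * q) by rewrite oddM oddM.
have h_even : ~~ odd (p * q)./2 by rewrite -mulnA mul2n doubleK oddM (negPf n_even).
apply/row_matrixP=> k.
have chiT := square_char_character iota two_neq0 r_even h_even (widen_ord (Defs.half_leq _) k).
have chiE := square_char_coords iota two_neq0 r_even h_even k.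
have := coords_unique (G := source) (@source_cov_e_neq0 )
  source_independent (kron_pullbackP chiT chiE) (LP _ _ chiT chiE).
rewrite -!scalemxAl -!rowE => /(congr1 (fun v => 2%:R^-1 *: v)).
by rewrite !scalerA mulVf // !scale1r.
Qed.

Lemma comp_mpoly_sum_sqr k l (t : k.-tuple {mpoly rat[l]}) :
  (\sum_i 'X_i ^+ 2) \mPo t = \sum_i tnth t i ^+ 2.
Proof.
rewrite raddf_sum /=; apply: eq_bigr => i _.
by rewrite rmorphXn /= comp_mpolyXU -tnth_nth.
Qed.

Lemma hspin_lambda_kron : hspin_lambda (p * q) = hspin_lambda p.
Proof.
rewrite /hspin_lambda; have [k ->] : exists k, n = (2 * k)%N by exists n./2; lia.
have ->: (2 * (2 * k) * q %/ 4 = k * q)%N by rewrite mulnA -mulnA mulKn.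
have ->: (2 * (2 * k) %/ 4 = k)%N by rewrite mulnA mulKn.
have q_odd : odd q by rewrite /= oddM.
(* The factor [q] is odd, hence coprime to 4, so it affects neither test in [hspin_lambda]. *)
rewrite oddM q_odd andbT Gauss_dvdl // (@coprimeXl 2 2) //.
by rewrite coprime2n.
Qed.

(** On the [HSpin] side both forms carry the same lambda, which leaves [q]; [q_SO] has coefficient
    1, so its multiplier absorbs lambda and becomes lambda times [p]. *)
Lemma kron_q_HSpin (b : nat) : hspin_lambda p *+ p = b%:R ->
  S2inl q./2 (q_HSpin p) *+ q + S2inr p./2 (q_SO q) *+ b
  = q_HSpin (p * q) \mPo [tuple \sum_j kron_pullback i j *: 'X_j | i < rank target].
Proof.
move=> lambda_b.
rewrite /q_HSpin /q_SO /S2inl /S2inr !comp_mpolyZ !comp_mpoly_sum_sqr.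
rewrite hspin_lambda_kron.
pose X (a : 'I_p./2) : {mpoly rat[p./2 + q./2]} := 'X_(lshift _ a).
pose Z (b : 'I_q./2) : {mpoly rat[p./2 + q./2]} := 'X_(rshift _ b).
have ->: \sum_(i < (p * q)./2) tnth [tuple \sum_j kron_pullback i j *: 'X_j | i < (p * q)./2] i ^+ 2
  = (\sum_a X a ^+ 2) *+ q + (\sum_b Z b ^+ 2) *+ p.
  rewrite -sum_sqr_kron; apply: eq_bigr => k _; rewrite tnth_mktuple.
  rewrite big_split_ord /=; congr ((_ + _) ^+ 2); apply: eq_bigr => l _;
  by rewrite mxE scaler_int.
rewrite scalerDr -!scalerMnr (scalerMnl _ _ p) lambda_b scaler_nat.
by congr (_ *: _ *+ _ + _ *+ _); apply: eq_bigr => i _; rewrite tnth_mktuple.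
Qed.

Lemma kron_dagger (b : nat) : hspin_lambda p *+ p = b%:R ->
  dagger iota source target phi' (q_HSpin (p * q))
    (S2inl _ (q_HSpin p) *+ q + S2inr _ (q_SO q) *+ b).
Proof.
move=> lambda_b; split.
  by move=> t [s sG ->]; have [u uG [-> _]] := kron_lift sG; exists u.
exists kron_pullback; split; first exact: kron_pullback_unique.
exact: kron_q_HSpin.
Qed.

End Kronecker.

Theorem theorem13
  (F : fieldType) (char_F : 2%N \notin [pchar F])
  (K : closedFieldType) (iota : {rmorphism F -> K})
  (n m : nat) (n_ge2 : (2 <= n)%N) (n_even : ~~ odd n) (m_ge1 : (1 <= m)%N)
  (phi : pt (prodgrp iota (Spin iota (2 * n)) (Spin iota (2 * m).+1)) ->
         pt (Spin iota (2 * n * (2 * m).+1)))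
  (phi_hom : is_hom _ _ phi)
  (phi_lift : forall x y,
     mem_grp (Spin iota (2 * n)) x ->
     mem_grp (Spin iota (2 * m).+1) y ->
     spin_cover (phi (x, y)) = tensmx (spin_cover x) (spin_cover y))
  (phi' : pt (prodgrp iota (HSpin iota (2 * n)) (SO iota (2 * m).+1)) ->
          pt (HSpin iota (2 * n * (2 * m).+1)))
  (phi'_hom : is_hom _ _ phi')
  (phi'_factor : forall x y,
     mem_grp (Spin iota (2 * n)) x ->
     mem_grp (Spin iota (2 * m).+1) y ->
     phi' (hspin_coset x, spin_cover y) = hspin_coset (phi (x, y))) :
  let multipliers (a b : nat) :=
    dagger iota
      (torprod iota (torHSpin iota (2 * n)) (torSO iota (2 * m).+1))
      (torHSpin iota (2 * n * (2 * m).+1)) phi'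
      (q_HSpin (2 * n * (2 * m).+1))
      (S2inl _ (q_HSpin (2 * n)) *+ a + S2inr _ (q_SO (2 * m).+1) *+ b) in
  [/\ n./2 = 0 %[mod 4] -> multipliers (2 * m).+1 n,
      n./2 = 2 %[mod 4] -> multipliers (2 * m).+1 (2 * n)%N
    & n./2 = 1 %[mod 4] \/ n./2 = 3 %[mod 4] -> multipliers (2 * m).+1 (4 * n)%N].
Proof.
have two_neq0 : 2%:R != 0 :> K.
  by move: char_F; rewrite -(fmorph_pchar iota) inE.
have n4 : ((2 * n) %/ 4 = n./2)%N by lia.
(* Here lambda is 1/2, 1 or 2 according to the case, and lambda times [2 * n] is [n], [2 * n] or
   [4 * n]. *)
split=> n_mod; apply: (kron_dagger _ _ phi_hom) => //; rewrite /hspin_lambda n4.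
- have [-> ->] : odd n./2 = false /\ (4 %| n./2)%N = true by lia.
  by rewrite mulrnA -(mulr_natl 2%:R^-1 2) mulfV.
- have [-> ->] : odd n./2 = false /\ (4 %| n./2)%N = false by lia.
  by [].
- have ->: odd n./2 by lia.
  by rewrite -mulrnA mulnA.
Qed.
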